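(* Let $\mathcal F=(F,<,+,\cdot,0,1,\ldots)$ be a definably complete locally o-minimal expansion of an ordered field. Let $G$ be a definable group, $X$ a definable $G$-set which is locally closed, and $A$ a $G$-invariant definable subset of $X$ which is closed in $X$. If the $G$-action on $X$ is definably proper, then there is a $G$-invariant definable continuous function $f:X\to F$ with $f^{-1}(0)=A$.
   Context: ''Definable'' means definable in $\mathcal F$ with parameters. $F$ has the order topology, $F^k$ the product topology, subsets the subspace topology; a subset of $F^k$ is called closed/locally closed/bounded if it is so in $F^k$. $\mathcal F$ is definably complete if every definable subset of $F$ has a supremum and an infimum in $F\cup\{\pm\infty\}$; it is locally o-minimal if for every definable $S\subseteq F$ and every $a\in F$ there is an open interval $I\ni a$ such that $S\cap I$ is a finite union of points and open intervals. A definable group is a definable set $G\subseteq F^n$ with a group structure whose multiplication and inversion are definable continuous maps. A definable $G$-set is a definable set $X\subseteq F^m$ with a group action $G\times X\to X$, $(g,x)\mapsto gx$, that is a definable continuous map. A definable continuous map $f:A\to B$ between definable sets $A\subseteq F^k$, $B\subseteq F^l$ is definably proper if for every closed and bounded definable $C\subseteq F^l$ with $C\subseteq B$, $f^{-1}(C)$ is closed and bounded in $F^k$. The $G$-action on $X$ is definably proper if the map $G\times X\to X\times X$, $(g,x)\mapsto(x,gx)$, is definably proper. A function $f$ on $X$ is $G$-invariant if $f(gx)=f(x)$ for all $g\in G$, $x\in X$. *)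

(* Defs.v *)
From HB Require Import structures.
From mathcomp Require Import all_boot all_order all_algebra.
From mathcomp Require Import all_classical all_reals all_analysis.
Set Implicit Arguments.
Unset Strict Implicit.
Unset Printing Implicit Defensive.
Import Order.TTheory GRing.Theory Num.Theory.
Import numFieldNormedType.Exports.
Local Open Scope classical_set_scope.
Local Open Scope ring_scope.

(* An expansion (F, <, +, *, 0, 1, ...) of the ordered field F: only the      *)
(* additional function and relation symbols, with their interpretations, are  *)
(* recorded. A constant is a function symbol of arity 0.                      *)
Record expansion (F : realFieldType) := Expansion {
  funsym : Type;
  fun_arity : funsym -> nat;
  fun_interp : forall s : funsym, ('I_(fun_arity s) -> F) -> F;
  relsym : Type;
  rel_arity : relsym -> nat;
  rel_interp : forall s : relsym, ('I_(rel_arity s) -> F) -> Prop }.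

Section FirstOrder.
Variables (F : realFieldType) (M : expansion F).

(* First-order formulas over M, with de Bruijn indices. *)
Inductive term :=
| Var of nat
| Zero
| One
| Add of term & term
| Mul of term & term
| App (s : funsym M) of ('I_(fun_arity s) -> term).

Inductive formula :=
| Eq of term & term
| Lt of term & term
| Rel (s : relsym M) of ('I_(rel_arity s) -> term)
| Not of formula
| And of formula & formula
| Ex of formula.

Fixpoint eval (v : nat -> F) (t : term) : F :=
  match t with
  | Var i => v i
  | Zero => 0
  | One => 1
  | Add t1 t2 => eval v t1 + eval v t2
  | Mul t1 t2 => eval v t1 * eval v t2
  | App s ts => fun_interp (fun i => eval v (ts i))
  end.

Fixpoint holds (v : nat -> F) (p : formula) : Prop :=
  match p with
  | Eq t1 t2 => eval v t1 = eval v t2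
  | Lt t1 t2 => eval v t1 < eval v t2
  | Rel s ts => rel_interp (fun i => eval v (ts i))
  | Not p => ~ holds v p
  | And p q => holds v p /\ holds v q
  | Ex p => exists y : F, holds (fun i => if i is j.+1 then v j else y) p
  end.

(* The variables of index < k are read in x, those of index >= k are the      *)
(* parameters, read in b.                                                     *)
Definition valuation (k : nat) (x : 'rV[F]_k) (b : nat -> F) (i : nat) : F :=
  if insub i is Some j then x 0 (j : 'I_k) else b (i - k)%N.

Definition definable (k : nat) (S : set 'rV[F]_k) : Prop :=
  exists (p : formula) (b : nat -> F), S = [set x | holds (valuation x b) p].

(* F is identified with F^1. *)
Definition definable1 (S : set F) : Prop :=
  definable [set x : 'rV[F]_1 | S (x 0 0)].

Definition definably_complete : Prop :=
  forall S : set F, definable1 S ->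
    supremums (EFin @` S) !=set0 /\ infimums (EFin @` S) !=set0.

Definition is_point (S : set F) : Prop := exists x, S = [set x].

(* itv_open_ends allows infinite ends. *)
Definition is_open_interval (S : set F) : Prop :=
  exists2 I : interval F, itv_open_ends I & S = [set` I].

Definition locally_o_minimal : Prop :=
  forall (S : set F) (a : F), definable1 S ->
    exists I : set F, [/\ is_open_interval I, I a &
      exists (N : nat) (J : 'I_N -> set F),
        (forall i, is_point (J i) \/ is_open_interval (J i)) /\
        S `&` I = \bigcup_i J i].

(* The topology of F is the library's one, which is its order topology (see   *)
(* real_order_nbhsE), and 'rV[F]_k carries the product topology.              *)

Definition locally_closed (k : nat) (S : set 'rV[F]_k) : Prop :=
  exists U C : set 'rV[F]_k, [/\ open U, closed C & S = U `&` C].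

Definition set_prod (k l : nat) (A : set 'rV[F]_k) (B : set 'rV[F]_l) :
    set 'rV[F]_(k + l) :=
  [set z | A (lsubmx z) /\ B (rsubmx z)].

(* Maps A -> B are represented by total functions whose values outside A are  *)
(* irrelevant.                                                                *)
Definition graph (k l : nat) (A : set 'rV[F]_k) (f : 'rV[F]_k -> 'rV[F]_l) :
    set 'rV[F]_(k + l) :=
  [set row_mx x (f x) | x in A].

Record definable_continuous_map (k l : nat) (A : set 'rV[F]_k)
    (B : set 'rV[F]_l) (f : 'rV[F]_k -> 'rV[F]_l) : Prop := {
  dcmap_dom : definable A;
  dcmap_cod : definable B;
  dcmap_sub : forall x, A x -> B (f x);
  dcmap_graph : definable (graph A f);
  dcmap_cont : {within A, continuous f} }.

Definition definable_continuous_function (k : nat) (A : set 'rV[F]_k)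
    (f : 'rV[F]_k -> F) : Prop :=
  [/\ definable A, definable (graph A (fun x => const_mx (f x) : 'rV[F]_1)) &
      {within A, continuous f}].

Definition definably_proper_map (k l : nat) (A : set 'rV[F]_k)
    (B : set 'rV[F]_l) (f : 'rV[F]_k -> 'rV[F]_l) : Prop :=
  definable_continuous_map A B f /\
  forall C : set 'rV[F]_l,
    definable C -> closed C -> bounded_set C -> C `<=` B ->
    closed (A `&` f @^-1` C) /\ bounded_set (A `&` f @^-1` C).

Record definable_group (n : nat) (G : set 'rV[F]_n)
    (mul : 'rV[F]_n -> 'rV[F]_n -> 'rV[F]_n) (inv : 'rV[F]_n -> 'rV[F]_n)
    (one : 'rV[F]_n) : Prop := {
  dgroup_one : G one;
  dgroup_mulA : forall x y z, G x -> G y -> G z ->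
    mul x (mul y z) = mul (mul x y) z;
  dgroup_mul1l : forall x, G x -> mul one x = x;
  dgroup_mul1r : forall x, G x -> mul x one = x;
  dgroup_mulVl : forall x, G x -> mul (inv x) x = one;
  dgroup_mulVr : forall x, G x -> mul x (inv x) = one;
  dgroup_mul : definable_continuous_map (set_prod G G) G
    (fun z => mul (lsubmx z) (rsubmx z));
  dgroup_inv : definable_continuous_map G G inv }.

Record definable_Gset (n m : nat) (G : set 'rV[F]_n)
    (mul : 'rV[F]_n -> 'rV[F]_n -> 'rV[F]_n) (one : 'rV[F]_n)
    (X : set 'rV[F]_m) (act : 'rV[F]_n -> 'rV[F]_m -> 'rV[F]_m) : Prop := {
  dGset_set : definable X;
  dGset_act1 : forall x, X x -> act one x = x;
  dGset_actM : forall g h x, G g -> G h -> X x ->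
    act (mul g h) x = act g (act h x);
  dGset_act : definable_continuous_map (set_prod G X) X
    (fun z => act (lsubmx z) (rsubmx z)) }.

Definition definably_proper_action (n m : nat) (G : set 'rV[F]_n)
    (X : set 'rV[F]_m) (act : 'rV[F]_n -> 'rV[F]_m -> 'rV[F]_m) : Prop :=
  definably_proper_map (set_prod G X) (set_prod X X)
    (fun z => row_mx (rsubmx z) (act (lsubmx z) (rsubmx z))).

Definition invariant_set (n m : nat) (G : set 'rV[F]_n)
    (act : 'rV[F]_n -> 'rV[F]_m -> 'rV[F]_m) (A : set 'rV[F]_m) : Prop :=
  forall g x, G g -> A x -> A (act g x).

Definition invariant_function (n m : nat) (G : set 'rV[F]_n)
    (X : set 'rV[F]_m) (act : 'rV[F]_n -> 'rV[F]_m -> 'rV[F]_m)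
    (f : 'rV[F]_m -> F) : Prop :=
  forall g x, G g -> X x -> f (act g x) = f x.

End FirstOrder.

(* Main.v *)
Require Import Defs.
From HB Require Import structures.
From mathcomp Require Import all_boot all_order all_algebra.
From mathcomp Require Import all_classical all_reals all_analysis.
Import Order.TTheory GRing.Theory Num.Theory.
Import numFieldNormedType.Exports.
Local Open Scope classical_set_scope.
Local Open Scope ring_scope.

(** Let W = cl X \ (X \ A), and let the height of y be the largest r in [0, 1]
    with r |y| <= 1 and r <= d(y, W). Heights are positive exactly on X \ A,
    and each set K_s = {y in X \ A of height >= s}, s > 0, is closed and
    bounded. The function f x = sup of the heights over the orbit G x is
    invariant, definable, and vanishes exactly on A; it is lower semicontinuous
    because the action is continuous. For upper semicontinuity at x0, take
    s > f x0 and a closed bounded neighbourhood B of x0 in X: by properness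
    {(g, x) : x in B, g x in K_s} is closed and bounded, so its projection to X
    is closed (definable completeness), and x0 is not in it. *)

Set Implicit Arguments.
Unset Strict Implicit.

(** * Definable predicates *)

Lemma row_normE (F : realFieldType) k (x : 'rV[F]_k) :
  `|x| = \big[Num.max/0]_ij `|x ij.1 ij.2|.
Proof. by rewrite /Num.Def.normr /= mx_normrE. Qed.

(** * Renaming of variables in formulas *)

Section Renaming.
Context {F : realFieldType} {M : expansion F}.

Fixpoint rename_term (r : nat -> nat) (t : term M) : term M :=
  match t with
  | Var i => Var M (r i)
  | Zero => Zero M
  | One => One M
  | Add t1 t2 => Add (rename_term r t1) (rename_term r t2)
  | Mul t1 t2 => Mul (rename_term r t1) (rename_term r t2)
  | App s ts => App (fun i => rename_term r (ts i))
  end.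

Fixpoint rename (r : nat -> nat) (p : formula M) : formula M :=
  match p with
  | Eq t1 t2 => Eq (rename_term r t1) (rename_term r t2)
  | Lt t1 t2 => Lt (rename_term r t1) (rename_term r t2)
  | Rel s ts => Rel (fun i => rename_term r (ts i))
  | Not p => Not (rename r p)
  | And p q => And (rename r p) (rename r q)
  | Ex p => Ex (rename (fun i => if i is j.+1 then (r j).+1 else 0%N) p)
  end.

Lemma eval_rename r v (t : term M) :
  Defs.eval v (rename_term r t) = Defs.eval (v \o r) t.
Proof.
elim: t => //= [t1 -> t2 ->|t1 -> t2 ->|s ts IH] //.
by congr fun_interp; apply/funext => i; exact: IH.
Qed.

Lemma holds_rename r v (p : formula M) :
  holds v (rename r p) = holds (v \o r) p.
Proof.
elim: p r v => /= [t1 t2|t1 t2|s ts|p IH|p IHp q IHq|p IH] r v;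
  rewrite ?eval_rename ?IH ?IHp ?IHq //.
  by congr rel_interp; apply/funext => i; rewrite eval_rename.
apply/propext; split=> -[y H]; exists y; move: H; rewrite IH;
  by congr holds; apply/funext => -[|i].
Qed.

End Renaming.

(* The environments in which formulas are evaluated: for instance an element of
   'rV_n * F assigns values to n + 1 free variables. *)
Class context (F : realFieldType) (E : Type) := coordinate : set (E -> F).

Section Contexts.
Context {F : realFieldType}.

#[export] Instance scalar_context : context F F := [set id].
#[export] Instance vector_context k : context F 'rV[F]_k :=
  [set f : 'rV[F]_k -> F | exists i, f = fun x => x 0 i].
#[export] Instance prod_context E E' (c : context F E) (c' : context F E') :
    context F (E * E')%type :=
  [set f : E * E' -> F | (exists2 g, coordinate g & f = g \o fst) \/
           (exists2 g, coordinate g & f = g \o snd)].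

Definition access E {c : context F E} (f : E -> F) :=
  coordinate f \/ exists a, f = cst a.

(** These are the changes of environment that leave a formula untouched: composing with [h] only
    changes which coordinate or constant each variable reads. *)
Definition projection E {c : context F E} E' {c' : context F E'}
    (h : E -> E') :=
  forall g, access g -> access (g \o h).

Lemma projection_id E {c : context F E} : projection (fun e : E => e).
Proof. by move=> g. Qed.

Lemma projection_fst E {c : context F E} E1 {c1 : context F E1}
    E2 {c2 : context F E2} (h : E -> E1 * E2) :
  projection h -> projection (fun e => (h e).1).
Proof.
move=> hp g [cg|[a ->]]; last by right; exists a.
by apply: (hp (g \o fst)); left; left; exists g.
Qed.

Lemma projection_snd E {c : context F E} E1 {c1 : context F E1}
    E2 {c2 : context F E2} (h : E -> E1 * E2) :
  projection h -> projection (fun e => (h e).2).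
Proof.
move=> hp g [cg|[a ->]]; last by right; exists a.
by apply: (hp (g \o snd)); left; right; exists g.
Qed.

Lemma projection_pair E {c : context F E} E1 {c1 : context F E1}
    E2 {c2 : context F E2} (h1 : E -> E1) (h2 : E -> E2) :
  projection h1 -> projection h2 -> projection (fun e => (h1 e, h2 e)).
Proof.
move=> hp1 hp2 g [[[k ck ->]|[k ck ->]]|[a ->]]; last by right; exists a.
  by apply: hp1; left.
by apply: hp2; left.
Qed.

Lemma projection_vector E {c : context F E} k (u : E -> 'rV[F]_k) :
  (forall i, access (fun e => u e 0 i)) -> projection u.
Proof.
move=> hu g [[i ->]|[a ->]]; [exact: hu | by right; exists a].
Qed.

Lemma access_coord E {c : context F E} k (u : E -> 'rV[F]_k) i :
  projection u -> access (fun e => u e 0 i).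
Proof. by move=> /(_ (fun x : 'rV[F]_k => x 0 i)); apply; left; exists i. Qed.

Lemma access_scalar E {c : context F E} (u : E -> F) :
  projection u -> access u.
Proof. by move=> /(_ id); apply; left. Qed.

End Contexts.

(** * Closure of definable predicates under connectives and quantifiers *)

Section Definability.
Context {F : realFieldType} {M : expansion F}.

(* Each free variable of p reads either a coordinate or a parameter. *)
Definition Def E {c : context F E} (Q : E -> Prop) :=
  exists (p : formula M) (s : nat -> E -> F),
    (forall i, access (s i)) /\ forall e, Q e <-> holds (s^~ e) p.

Section Connectives.
Context E {c : context F E}.

Lemma Def_ext (P Q : E -> Prop) : (forall e, P e <-> Q e) -> Def P -> Def Q.
Proof.
move=> PQ [p [s [hs Hs]]]; exists p, s; split=> // e.
by rewrite -PQ.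
Qed.

Lemma Def_comp E' {c' : context F E'} (h : E -> E') (Q : E' -> Prop) :
  projection h -> Def Q -> Def (fun e => Q (h e)).
Proof.
move=> hp [p [s [hs Hs]]]; exists p, (fun i => s i \o h).
by split=> [i|e]; [apply: hp | rewrite Hs].
Qed.

Lemma Def_not (P : E -> Prop) : Def P -> Def (fun e => ~ P e).
Proof.
move=> [p [s [hs Hs]]]; exists (Not p), s; split=> // e /=.
by split=> H /Hs.
Qed.

Lemma Def_and (P Q : E -> Prop) : Def P -> Def Q -> Def (fun e => P e /\ Q e).
Proof.
move=> [p [s [hs Hs]]] [q [t [ht Ht]]].
(* The two formulas read their variables independently, so those of [p] move to the even indices and
   those of [q] to the odd ones. *)
exists (And (rename double p) (rename (fun i => i.*2.+1) q)).
exists (fun i => if odd i then t i./2 else s i./2); split=> [i|e /=].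
  by case: ifP.
rewrite !holds_rename Hs Ht.
have -> : (fun i => (if odd i then t i./2 else s i./2) e) \o double = s^~ e.
  by apply/funext => i /=; rewrite odd_double doubleK.
suff -> : (fun i => (if odd i then t i./2 else s i./2) e) \o
    (fun i => i.*2.+1) = t^~ e by [].
by apply/funext => i /=; rewrite odd_double uphalf_double.
Qed.

Lemma Def_or (P Q : E -> Prop) : Def P -> Def Q -> Def (fun e => P e \/ Q e).
Proof.
move=> hP hQ; apply: Def_ext (Def_not (Def_and (Def_not hP) (Def_not hQ))).
move=> e; split=> [|[?|?] []//].
by move=> /not_andP[] /contrapT; [left|right].
Qed.

Lemma Def_imply (P Q : E -> Prop) : Def P -> Def Q -> Def (fun e => P e -> Q e).
Proof.
move=> hP hQ; apply: Def_ext (Def_or (Def_not hP) hQ).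
move=> e; split=> [[]//|PQ].
by have [/PQ|] := pselect (P e); [right|left].
Qed.

Lemma Def_true : Def (fun _ : E => True).
Proof.
exists (Eq (Zero M) (Zero M)), (fun _ => cst 0).
by split=> // i; right; exists 0.
Qed.

Lemma Def_const (P : Prop) : Def (fun _ : E => P).
Proof.
have [p|np] := pselect P; first by apply: Def_ext Def_true.
by apply: Def_ext (Def_not Def_true) => e; split=> // /(_ I).
Qed.

Lemma Def_forall_fin (I : finType) (P : I -> E -> Prop) :
  (forall i, Def (P i)) -> Def (fun e => forall i, P i e).
Proof.
move=> hP.
suff H (s : seq I) : @Def E c (fun e => forall i, i \in s -> P i e).
  apply: Def_ext (H (enum I)) => e; split=> [H' i|H' i _]; apply: H'.
  by rewrite mem_enum.
elim: s => [|j s IH]; first by apply: Def_ext Def_true.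
apply: Def_ext (Def_and (hP j) IH) => e; split=> [[Pj Ps] i|H].
  by rewrite inE => /orP[/eqP->//|]; exact: Ps.
by split=> [|i si]; apply: H; rewrite inE ?eqxx ?si ?orbT.
Qed.

Lemma Def_exists (Q : E -> F -> Prop) :
  Def (fun ey : E * F => Q ey.1 ey.2) -> Def (fun e => exists y, Q e y).
Proof.
move=> [p [s [hs Hs]]].
(* [Some g] marks a variable reading the environment or a constant, [None] one reading the
   quantified value [y]. *)
have /choice[t Ht] i : exists o : option (E -> F),
    if o is Some g then access g /\ s i = g \o fst else s i = snd.
  case: (hs i) => [[[g cg ->]|[g -> ->]]|[a ->]].
  - by exists (Some g); split=> //; left.
  - by exists None.
  - by exists (Some (cst a)); split=> //; right; exists a.
(* All variables reading [y] merge into the bound index 0. The value [cst 0] below fills indices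
   that the renamed formula no longer reads. *)
exists (Ex (rename (fun i => if t i is Some _ then i.+1 else 0%N) p)).
exists (fun i => if t i is Some g then g else cst 0); split=> [i|e /=].
  by case: (t i) (Ht i) => [g []//|_]; right; exists 0.
have E1 y : holds (s^~ (e, y)) p <->
    holds (fun i => if i is j.+1 then (if t j is Some g then g else cst 0) e
      else y) (rename (fun i => if t i is Some _ then i.+1 else 0%N) p).
  rewrite holds_rename; suff -> : s^~ (e, y) = (fun i =>
    if i is j.+1 then (if t j is Some g then g else cst 0) e else y) \o
    (fun i => if t i is Some _ then i.+1 else 0%N) by [].
  apply/funext => i /=; case E0: (t i) (Ht i) => [g|]; last by move=> ->.
  by move=> [_ ->]; rewrite E0.
by split=> -[y H]; exists y; [apply/E1/(Hs (e, y)) | apply/(Hs (e, y))/E1].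
Qed.

End Connectives.

Lemma Def_exists_vector k E {c : context F E} (Q : E -> 'rV[F]_k -> Prop) :
  Def (fun ez : E * 'rV[F]_k => Q ez.1 ez.2) -> Def (fun e => exists z, Q e z).
Proof.
elim: k => [|k IH] in E c Q *.
  move=> hQ; apply: (@Def_ext _ _ (fun e => Q e 0)) => [e|].
    by split=> [He|[z]]; [exists 0 | rewrite thinmx0].
  apply: (@Def_comp _ _ _ _ (fun e => (e, 0 : 'rV[F]_0)) _ _ hQ).
  apply: projection_pair; first exact: projection_id.
  by apply: projection_vector => -[].
move=> hQ.
(* A vector of length [k.+1] is split into its first entry [y] and the remaining row [z]. *)
apply: (@Def_ext _ _ (fun e => exists z : 'rV[F]_k, exists y : F,
    Q e (row_mx (y%:M : 'rV_1) z))) => [e|].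
  split=> [[z [y Hz]]|[z Hz]]; first by exists (row_mx y%:M z).
  exists (@rsubmx _ 1 1 k z), (@lsubmx _ 1 1 k z 0 0).
  by rewrite -mx11_scalar hsubmxK.
apply: IH; apply: Def_exists.
pose h (e : E * 'rV[F]_k * F) := (e.1.1, row_mx (e.2%:M : 'rV_1) e.1.2).
apply: (@Def_comp _ _ _ _ h _ _ hQ).
apply: projection_pair.
  by do 2 apply: projection_fst; apply: projection_id.
apply: projection_vector => i; case: (split_ordP i) => j ->.
  under eq_fun do rewrite row_mxEl mxE (ord1 j) eqxx mulr1n.
  by apply: access_scalar; apply: projection_snd; apply: projection_id.
under eq_fun do rewrite row_mxEr.
by apply: access_coord; apply: projection_snd; apply: projection_fst;
  apply: projection_id.
Qed.

Lemma Def_forall E {c : context F E} (Q : E -> F -> Prop) :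
  Def (fun ey : E * F => Q ey.1 ey.2) -> Def (fun e => forall y, Q e y).
Proof.
move=> hQ; have hN := Def_exists (Q := fun e y => ~ Q e y) (Def_not hQ).
apply: Def_ext (Def_not hN) => e.
split=> [/forallNP H y|H [y]]; last by apply.
exact: contrapT (H y).
Qed.

Lemma Def_forall_vector k E {c : context F E} (Q : E -> 'rV[F]_k -> Prop) :
  Def (fun ez : E * 'rV[F]_k => Q ez.1 ez.2) -> Def (fun e => forall z, Q e z).
Proof.
move=> hQ; have hN := Def_exists_vector (Q := fun e y => ~ Q e y) (Def_not hQ).
apply: Def_ext (Def_not hN) => e.
split=> [/forallNP H y|H [y]]; last by apply.
exact: contrapT (H y).
Qed.

Definition DefF E {c : context F E} (f : E -> F) :=
  Def (fun ey : E * F => f ey.1 = ey.2).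

Definition DefV k E {c : context F E} (u : E -> 'rV[F]_k) :=
  forall i, DefF (fun e => u e 0 i).


End Definability.
Arguments Def {F} M {E c} Q.
Arguments DefF {F} M {E c} f.
Arguments DefV {F} M {k E c} u.

Ltac projections :=
  repeat first [ exact: projection_id | apply: projection_fst
               | apply: projection_snd ].

(** * Definable functions, arithmetic and norms *)

Section DefinableFunctions.
Context {F : realFieldType} {M : expansion F}.

(** Since [u] need not be a mere projection, its value is quantified: some [z] has the coordinates
    of [u e] and lies in [S]. *)
Lemma Def_mem k (S : set 'rV[F]_k) E {c : context F E} (u : E -> 'rV[F]_k) :
  definable M S -> DefV M u -> Def M (fun e => S (u e)).
Proof.
move=> [p [b ->]] hu.
have hS : Def M (fun x : 'rV[F]_k => holds (valuation x b) p).
  exists p, (fun i x => valuation x b i); split=> // i.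
  rewrite /valuation; case: insubP => [j _ _|_];
    last by right; exists (b (i - k)%N).
  by apply: access_coord; exact: projection_id.
apply: (@Def_ext _ _ _ _ (fun e => exists z : 'rV[F]_k,
    (forall i, u e 0 i = z 0 i) /\ holds (valuation z b) p)) => [e|].
  split=> [[z [uz Hz]]|H]; last by exists (u e).
  by suff -> : u e = z by []; apply/rowP.
apply: Def_exists_vector; apply: Def_and.
  apply: Def_forall_fin => i.
  pose h (ez : E * 'rV[F]_k) := (ez.1, ez.2 0 i).
  apply: (@Def_comp _ _ _ _ _ _ h _ _ (hu i)).
  apply: projection_pair; first by projections.
  move=> g [->|[a ->]]; last by right; exists a.
  by apply: access_coord; projections.
by apply: (Def_comp _ hS); projections.
Qed.

Lemma Def_definable k (S : 'rV[F]_k -> Prop) : Def M S -> definable M S.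
Proof.
move=> [p [s [hs Hs]]].
have /choice[t Ht] i : exists o : 'I_k + F,
    s i = if o is inl j then fun x => x 0 j
          else cst (if o is inr a then a else 0).
  case: (hs i) => [[j ->]|[a ->]]; [by exists (inl j) | by exists (inr a)].
(* A variable reading a coordinate takes the index of that coordinate; one reading a constant moves
   to [k + i], where [valuation] finds the [i]-th parameter. *)
exists (rename (fun i => if t i is inl j then val j else k + i)%N p).
exists (fun i => if t i is inr a then a else 0).
apply/funext => x; apply/propext; rewrite Hs /= holds_rename.
suff -> : s^~ x = valuation x (fun i => if t i is inr a then a else 0) \o
   (fun i => if t i is inl j then val j else k + i)%N by [].
apply/funext => i /=; rewrite Ht /valuation; case E: (t i) => [j|a].
  by rewrite valK.
by rewrite insubF ?ltnNge ?leq_addr //= addKn E.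
Qed.

Lemma Def_definable1 (S : F -> Prop) : Def M S -> definable1 M S.
Proof.
move=> hS; apply: Def_definable; apply: (Def_comp _ hS).
move=> g [->|[a ->]]; last by right; exists a.
by apply: access_coord; projections.
Qed.

Section Functions.
Context E {c : context F E}.

Lemma Def_eq_access (f g : E -> F) :
  access f -> access g -> Def M (fun e => f e = g e).
Proof.
move=> hf hg; exists (Eq (Var M 0) (Var M 1)).
exists (fun i => if i is 0 then f else g).
by split=> // -[].
Qed.

Lemma Def_lt_access (f g : E -> F) :
  access f -> access g -> Def M (fun e => f e < g e).
Proof.
move=> hf hg; exists (Lt (Var M 0) (Var M 1)).
exists (fun i => if i is 0 then f else g).
by split=> // -[].
Qed.

End Functions.

Section Functions.
Context E {c : context F E}.

Lemma DefF_access (f : E -> F) : access f -> DefF M f.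
Proof.
move=> hf; apply: (@Def_eq_access _ _ (fun ey => f ey.1)).
  by apply: projection_fst hf; exact: projection_id.
by apply: access_scalar; projections.
Qed.

Lemma DefF_cst a : DefF M (fun _ : E => a).
Proof. by apply: DefF_access; right; exists a. Qed.

Lemma DefF_comp E' {c' : context F E'} (h : E -> E') (f : E' -> F) :
  projection h -> DefF M f -> DefF M (fun e => f (h e)).
Proof.
move=> hp hf; apply: (@Def_comp _ _ _ _ _ _ (fun ey => (h ey.1, ey.2)) _ _ hf).
apply: projection_pair; last by projections.
by move=> g /hp; apply: projection_fst; exact: projection_id.
Qed.

Lemma Def_bind (f : E -> F) (Q : E -> F -> Prop) :
  DefF M f -> Def M (fun ey : E * F => Q ey.1 ey.2) ->
  Def M (fun e => Q e (f e)).
Proof.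
move=> hf hQ; apply: (@Def_ext _ _ _ _ (fun e => exists y, f e = y /\ Q e y)).
  by move=> e; split=> [[y [->]]//|H]; exists (f e).
by apply: Def_exists; apply: Def_and.
Qed.

End Functions.

(** Both arguments are bound to fresh scalars by [Def_bind], so that definability of [op] need only
    be checked on three variables. *)
Lemma DefF_op2 (op : F -> F -> F) :
  Def M (fun x : F * F * F => op x.1.1 x.1.2 = x.2) ->
  forall E (c : context F E) (f g : E -> F),
    DefF M f -> DefF M g -> DefF M (fun e => op (f e) (g e)).
Proof.
move=> hop E c f g hf hg.
apply: (Def_bind (f := fun ey : E * F => f ey.1)
   (Q := fun (ey : E * F) z => op z (g ey.1) = ey.2)).
  by apply: (DefF_comp _ hf); projections.
apply: (Def_bind (f := fun ey : E * F * F => g ey.1.1)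
   (Q := fun (ey : E * F * F) z => op ey.2 z = ey.1.2)).
  by apply: (DefF_comp _ hg); projections.
pose h (ey : E * F * F * F) := (ey.1.2, ey.2, ey.1.1.2).
apply: (@Def_comp _ _ _ _ _ _ h _ _ hop).
by do ?apply: projection_pair; projections.
Qed.

Section Operations.
Context E {c : context F E}.

Lemma Def_eq (f g : E -> F) :
  DefF M f -> DefF M g -> Def M (fun e => f e = g e).
Proof. by move=> hf hg; apply: (Def_bind (Q := fun e y => f e = y) hg). Qed.

Lemma Def_lt (f g : E -> F) :
  DefF M f -> DefF M g -> Def M (fun e => f e < g e).
Proof.
move=> hf hg; apply: (Def_bind (Q := fun e y => f e < y) hg).
apply: (Def_bind (f := fun ey : E * F => f ey.1)
   (Q := fun (ey : E * F) y => y < ey.2)).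
  by apply: (DefF_comp _ hf); projections.
by apply: Def_lt_access; apply: access_scalar; projections.
Qed.

Lemma Def_le (f g : E -> F) :
  DefF M f -> DefF M g -> Def M (fun e => f e <= g e).
Proof.
move=> hf hg; apply: Def_ext (Def_not (Def_lt hg hf)) => e.
by rewrite leNgt; split => /negP.
Qed.

Lemma DefF_add (f g : E -> F) :
  DefF M f -> DefF M g -> DefF M (fun e => f e + g e).
Proof.
apply: DefF_op2.
exists (Eq (Add (Var M 0) (Var M 1)) (Var M 2)),
  (fun i => if i is 0 then (fun x => x.1.1)
            else if i is 1 then (fun x => x.1.2) else snd).
by split=> // -[|[|i]]; apply: access_scalar; projections.
Qed.

Lemma DefF_mul (f g : E -> F) :
  DefF M f -> DefF M g -> DefF M (fun e => f e * g e).
Proof.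
apply: DefF_op2.
exists (Eq (Mul (Var M 0) (Var M 1)) (Var M 2)),
  (fun i => if i is 0 then (fun x => x.1.1)
            else if i is 1 then (fun x => x.1.2) else snd).
by split=> // -[|[|i]]; apply: access_scalar; projections.
Qed.

Lemma DefF_opp (f : E -> F) : DefF M f -> DefF M (fun e => - f e).
Proof.
move=> /(DefF_mul (DefF_cst (-1))).
by under eq_fun do rewrite mulN1r.
Qed.

End Operations.

Section Norm.
Context E {c : context F E}.

Lemma DefF_max (f g : E -> F) : DefF M f -> DefF M g ->
  DefF M (fun e => Num.max (f e) (g e)).
Proof.
apply: DefF_op2; apply: (@Def_ext _ _ _ _ (fun x : F * F * F =>
  (x.1.1 < x.1.2 /\ x.1.2 = x.2) \/ (x.1.2 <= x.1.1 /\ x.1.1 = x.2))).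
  move=> [[x y] z] /=; rewrite /Num.max /Order.max.
  case: ltP => _; split => [[[]//|[]//]|->]; by [left | right].
have p1 : DefF M (fun x : F * F * F => x.1.1).
  by apply: DefF_access; apply: access_scalar; projections.
have p2 : DefF M (fun x : F * F * F => x.1.2).
  by apply: DefF_access; apply: access_scalar; projections.
have p3 : DefF M (fun x : F * F * F => x.2).
  by apply: DefF_access; apply: access_scalar; projections.
by apply: Def_or; apply: Def_and;
  first [exact: Def_lt | exact: Def_eq | exact: Def_le].
Qed.

Lemma DefF_abs (f : E -> F) : DefF M f -> DefF M (fun e => `|f e|).
Proof.
move=> hf; under eq_fun do rewrite -maxrN.
by apply: DefF_max => //; exact: DefF_opp.
Qed.

Lemma DefF_norm k (u : E -> 'rV[F]_k) : DefV M u -> DefF M (fun e => `|u e|).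
Proof.
move=> hu; under eq_fun do rewrite row_normE.
elim: (index_enum _) => [|i s IH].
  by under eq_fun do rewrite big_nil; exact: DefF_cst.
under eq_fun do rewrite big_cons ord1; apply: DefF_max => //.
exact: DefF_abs.
Qed.

Lemma DefV_projection k (u : E -> 'rV[F]_k) : projection u -> DefV M u.
Proof. by move=> hu i; apply: DefF_access; exact: access_coord. Qed.

Lemma DefV_cst k (x : 'rV[F]_k) : DefV M (fun _ : E => x).
Proof. by move=> i; exact: DefF_cst. Qed.

Lemma DefV_sub k (u v : E -> 'rV[F]_k) : DefV M u -> DefV M v ->
  DefV M (fun e => u e - v e).
Proof.
move=> hu hv i; under eq_fun do rewrite !mxE.
by apply: DefF_add => //; exact: DefF_opp.
Qed.

Lemma DefV_row_mx k l (u : E -> 'rV[F]_k) (v : E -> 'rV[F]_l) :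
  DefV M u -> DefV M v -> DefV M (fun e => row_mx (u e) (v e)).
Proof.
move=> hu hv i; case: (split_ordP i) => j ->.
  by under eq_fun do rewrite row_mxEl.
by under eq_fun do rewrite row_mxEr.
Qed.

Lemma DefV_lsubmx k l (u : E -> 'rV[F]_(k + l)) :
  DefV M u -> DefV M (fun e => lsubmx (u e)).
Proof. by move=> hu i; under eq_fun do rewrite mxE. Qed.

Lemma DefV_rsubmx k l (u : E -> 'rV[F]_(k + l)) :
  DefV M u -> DefV M (fun e => rsubmx (u e)).
Proof. by move=> hu i; under eq_fun do rewrite mxE. Qed.

End Norm.
End DefinableFunctions.

(** Reads definability off the syntax of the predicate, with the definable sets among the hypotheses
    as atoms. *)
Ltac definability :=
  repeat match goal with
  | |- Def _ (fun e => ?P) => apply: Def_const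
  | |- Def _ (fun e => _ /\ _) => apply: Def_and
  | |- Def _ (fun e => _ \/ _) => apply: Def_or
  | |- Def _ (fun e => ~ _) => apply: Def_not
  | |- Def _ (fun e => is_true (_ < _)) => apply: Def_lt
  | |- Def _ (fun e => is_true (_ <= _)) => apply: Def_le
  | |- Def _ (fun e => _ = _) => apply: Def_eq
  | |- Def _ (fun e => exists y, _) =>
      first [apply: Def_exists_vector | apply: Def_exists]
  | |- Def _ (fun e => forall y, _) =>
      first [ apply: Def_imply | apply: Def_forall_vector | apply: Def_forall
            | apply: Def_forall_fin => ?]
  | H : definable _ ?S |- Def _ ?S => apply: (Def_mem (u := fun e => e) H)
  | H : definable _ ?S |- Def _ (fun e => ?S _) => apply: (Def_mem H)
  | |- DefF _ (fun e => `|_|) => first [apply: DefF_norm | apply: DefF_abs]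
  | |- DefF _ Num.norm => apply: (DefF_norm (u := fun e => e))
  | |- DefF _ (fun e => _ + _) => apply: DefF_add
  | |- DefF _ (fun e => - _) => apply: DefF_opp
  | |- DefF _ (fun e => _ * _) => apply: DefF_mul
  | |- DefV _ (fun e => _ - _) => apply: DefV_sub
  | |- DefV _ (fun e => row_mx _ _) => apply: DefV_row_mx
  | |- DefV _ lsubmx => apply: (DefV_lsubmx (u := fun e => e))
  | |- DefV _ rsubmx => apply: (DefV_rsubmx (u := fun e => e))
  | |- DefV _ (fun e => lsubmx _) => apply: DefV_lsubmx
  | |- DefV _ (fun e => rsubmx _) => apply: DefV_rsubmx
  | |- DefV _ (fun e => ?x) => apply: DefV_cst
  | |- DefF _ (fun e => ?x) => apply: DefF_cst
  | |- DefV _ _ => apply: DefV_projection; solve [projections]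
  | |- DefF _ _ => apply: DefF_access;
      first [apply: access_coord | apply: access_scalar]; solve [projections]
  end.

(** * Closed bounded definable sets *)

Section RowVectors.
Context {F : realFieldType}.

Lemma le_coord_norm k (x : 'rV[F]_k) i : `|x 0 i| <= `|x|.
Proof.
by rewrite row_normE; apply/bigmax_geP; right => /=; exists (0, i).
Qed.

Lemma row_norm_lt k (x : 'rV[F]_k) e :
  0 < e -> (forall i, `|x 0 i| < e) -> `|x| < e.
Proof.
move=> e0 xe; rewrite row_normE bigmax_lt // => -[i j] _ /=.
by rewrite ord1.
Qed.

Lemma row_norm_le k (x : 'rV[F]_k) e :
  0 <= e -> (forall i, `|x 0 i| <= e) -> `|x| <= e.
Proof.
move=> e0 xe; rewrite row_normE bigmax_le // => -[i j] _ /=.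
by rewrite ord1.
Qed.

Lemma nbhs_rowP k (x : 'rV[F]_k) (P : set 'rV[F]_k) :
  nbhs x P <-> exists2 e, 0 < e & forall y, `|x - y| < e -> P y.
Proof.
split=> [/nbhs_ballP|] [e e0 xP]; last apply/nbhs_ballP; exists e => // y.
  by move=> xy; apply: xP; rewrite -ball_normE.
by rewrite -ball_normE; exact: xP.
Qed.

Lemma closed_rowP k (P : set 'rV[F]_k) : closed P <->
  forall x, (forall e, 0 < e -> exists2 y, P y & `|x - y| < e) -> P x.
Proof.
split=> [cP x xP|H x xP].
  apply: cP => U /nbhs_rowP[e e0 xU].
  by have [y Py /xU] := xP e e0; exists y.
apply: H => e e0; have [|y [Py xy]] := xP (fun y => `|x - y| < e).
  by apply/nbhs_rowP; exists e.
by exists y.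
Qed.

Lemma closure_rowP k (S : set 'rV[F]_k) (x : 'rV[F]_k) :
  closure S x <-> forall e, 0 < e -> exists y, S y /\ `|x - y| < e.
Proof.
split=> [clS e e0|H U /nbhs_rowP[e e0 xU]].
  have [|y [Sy xy]] := clS (fun y => `|x - y| < e); last by exists y.
  by apply/nbhs_rowP; exists e.
by have [y [Sy /xU Uy]] := H e e0; exists y.
Qed.

Lemma bounded_rowP k (P : set 'rV[F]_k) :
  bounded_set P <-> exists b, forall x, P x -> `|x| <= b.
Proof.
split=> [[b [_ Hb]]|[b Hb]].
  by exists (b + 1) => x Px; apply: Hb Px; rewrite ltrDl.
exists b; split; first exact: num_real.
by move=> y yb x /Hb /le_trans; apply; exact: ltW.
Qed.

(** The ball is taken inside the open set [U] of a presentation of [S] as [U] meet [C]; the closed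
    set [C] contains the closure of [S]. *)
Lemma locally_closed_locally k (S : set 'rV[F]_k) x : locally_closed S -> S x ->
  exists2 e, 0 < e & forall y, `|x - y| < e -> closure S y -> S y.
Proof.
move=> [U [C [oU cC ->]]] [Ux _].
have /nbhs_rowP[e e0 eU] : nbhs x U by exact: oU.
exists e => // y /eU Uy yUC; split=> //; apply: cC.
by apply: closureS yUC => z [].
Qed.

End RowVectors.

(** * Consequences of definable completeness *)

Section Completeness.
Context {F : realFieldType} {M : expansion F} (hdc : definably_complete M).

Lemma Def_sup (S : F -> Prop) b : Def M S -> (exists x, S x) ->
  (forall x, S x -> x <= b) ->
  exists s, (forall x, S x -> x <= s) /\
            forall u, (forall x, S x -> x <= u) -> s <= u.
Proof.
move=> hS [x0 Sx0] Sb.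
have [[[s| |] [us ls]] _] := hdc (Def_definable1 hS).
- exists s; split=> [x Sx|u Su].
    by rewrite -lee_fin; apply: us; exists x.
  by rewrite -lee_fin; apply: ls => _ [x Sx <-]; rewrite lee_fin; exact: Su.
- suff : (+oo <= b%:E)%E by [].
  by apply: ls => _ [x Sx <-]; rewrite lee_fin; exact: Sb.
- suff : (x0%:E <= -oo)%E by [].
  by apply: us; exists x0.
Qed.

(* Coordinates outside S are chosen one at a time: the next one is the limit,
   as e tends to 0, of the infimum of that coordinate over the points of P
   which are e-close to c on S. *)
Lemma closed_bounded_lift k (P : set 'rV[F]_k) (S : {set 'I_k}) (c : 'rV[F]_k) :
  definable M P -> closed P -> bounded_set P ->
  (forall e, 0 < e ->
    exists2 z, P z & forall i, i \in S -> `|z 0 i - c 0 i| < e) ->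
  exists2 z, P z & forall i, i \in S -> z 0 i = c 0 i.
Proof.
move=> hP cP /bounded_rowP[b Pb].
elim: {S}_.+1 {-2}S (ltnSn #|~: S|) c => // m IH S Sm c Sc.
(* When no coordinate is left to choose, [c] is itself a limit of points of [P]. *)
have [[j jS]|/forallNP nS] := pselect (exists j, j \notin S); last first.
  exists c => //; apply/(proj1 (closed_rowP _) cP) => e e0.
  have [z Pz zc] := Sc e e0.
  exists z => //; apply: row_norm_lt => // i; rewrite !mxE distrC; apply: zc.
  by apply: contrapT => /negP; exact: nS.
(* [T] collects the lower bounds of the [j]-th coordinate valid at some scale [e]; its supremum [t]
   is the limit of the infima. *)
pose T t := exists e, 0 < e /\ forall z, P z ->
  (forall i, i \in S -> `|z 0 i - c 0 i| < e) -> t <= z 0 j.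
have hT : Def M T by rewrite /T; definability.
have Pbj z : P z -> - b <= z 0 j <= b.
  by move=> Pz; rewrite -ler_norml (le_trans (le_coord_norm z j)) ?Pb.
have [|t|t [ut lt]] := @Def_sup T b hT.
- by exists (- b), 1; split=> // z /Pbj/andP[].
- move=> [e [e0 He]]; have [z Pz zc] := Sc e e0.
  by apply: le_trans (He z Pz zc) _; case/andP: (Pbj z Pz).
pose c' : 'rV[F]_k := \row_i if i == j then t else c 0 i.
have c'S i : i \in S -> c' 0 i = c 0 i.
  by rewrite mxE; case: eqP => // ->; rewrite (negbTE jS).
have [||z Pz zc] := IH (j |: S) _ c'.
- rewrite -ltnS; apply: leq_trans Sm; rewrite ltnS; apply: proper_card.
  apply/properP; split; first by rewrite finset.setCS finset.subsetUr.
  by exists j; rewrite !inE ?eqxx ?jS.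
- move=> e e0.
  (* At scale [e1] the [j]-th coordinate stays above [t - e]. As [t + e] is not in [T], some point
     at the smaller scale [min e e1] has it below [t + e]. *)
  have [t1 [e1 [e10 He1]] tt1] : exists2 t1, T t1 & t - e < t1.
    apply: contrapT => /forall2NP H; have : t <= t - e.
      by apply: lt => x Tx; case: (H x) => // /negP; rewrite -leNgt.
    by rewrite lerDl oppr_ge0 leNgt e0.
  have : ~ T (t + e) by move=> /ut; rewrite gerDl leNgt e0.
  move=> /forallNP /(_ (Num.min e e1)) /not_andP[].
    by rewrite lt_min e0 e10.
  move=> /existsNP[z /not_implyP[Pz /not_implyP[zc /negP]]].
  rewrite -ltNge => zt.
  exists z => // i; rewrite !inE => /orP[/eqP ->|iS].
    rewrite mxE eqxx ltr_distl zt andbT; apply: lt_le_trans tt1 _.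
    by apply: He1 => // l lS; have := zc l lS; rewrite lt_min => /andP[].
  by rewrite c'S //; have := zc i iS; rewrite lt_min => /andP[].
exists z => // i iS; rewrite zc ?c'S //.
by rewrite inE iS orbT.
Qed.

(** This closedness of projections stands in for compactness. It is [closed_bounded_lift] with the
    last [m] coordinates prescribed; the zero block of the centre is arbitrary. *)
Lemma closed_bounded_projection n m (P : set 'rV[F]_(n + m)) (x : 'rV[F]_m) :
  definable M P -> closed P -> bounded_set P ->
  (forall e, 0 < e -> exists2 z, P z & `|x - rsubmx z| < e) ->
  exists g, P (row_mx g x).
Proof.
move=> hP cP bP Px.
have [|z Pz zx] := @closed_bounded_lift _ P [set rshift n i | i in 'I_m]
    (row_mx 0 x) hP cP bP.
  move=> e /Px[z Pz xz]; exists z => // _ /imsetP[i _ ->].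
  rewrite row_mxEr distrC; apply: le_lt_trans xz.
  by apply: le_trans (le_coord_norm _ i); rewrite !mxE.
exists (lsubmx z); suff <- : rsubmx z = x by rewrite hsubmxK.
by apply/rowP => i; rewrite mxE zx ?row_mxEr // imset_f.
Qed.

End Completeness.

Lemma within_continuousP {F : realFieldType} k
    (V : pseudoMetricNormedZmodType F) (A : set 'rV[F]_k) (f : 'rV[F]_k -> V) :
  {within A, continuous f} <-> forall x, A x -> forall e, 0 < e ->
    exists2 d, 0 < d & forall y, A y -> `|x - y| < d -> `|f x - f y| < e.
Proof.
rewrite subspace_continuousP; split=> H x Ax.
  move=> e e0; have /cvgrPdist_lt/(_ e e0)/nbhs_rowP[d d0 Hd] := H x Ax.
  by exists d => // y Ay xy; exact: Hd.
apply/cvgrPdist_lt => e /(H x Ax)[d d0 Hd]; apply/nbhs_rowP.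
by exists d => // y xy Ay; exact: Hd.
Qed.

(** * The supremum of heights over orbits *)

Section InvariantFunction.
Context {F : realFieldType} {M : expansion F}.
Context (hdc : definably_complete M).
Context {n m : nat} {G : set 'rV[F]_n}.
Context {mul : 'rV[F]_n -> 'rV[F]_n -> 'rV[F]_n}.
Context {inv : 'rV[F]_n -> 'rV[F]_n} {one : 'rV[F]_n}.
Context (hG : definable_group M G mul inv one).
Context {X : set 'rV[F]_m} {act : 'rV[F]_n -> 'rV[F]_m -> 'rV[F]_m}.
Context (hX : definable_Gset M G mul one X act).
Context (hXlc : locally_closed X).
Context {A : set 'rV[F]_m}.
Context (hA : definable M A) (hAX : A `<=` X).
Context (hAinv : invariant_set G act A).
Context (hAcl : closed (A : set (subspace X))).
Context (hproper : definably_proper_action M G X act).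

Let definable_X : definable M X := dGset_set hX.

(** The total function [act] is arbitrary off [G] and [X], so formulas use this graph, which also
    records membership in both. *)
Definition actgraph : set 'rV[F]_(n + m + m) :=
  graph (set_prod G X) (fun z => act (lsubmx z) (rsubmx z)).

Let definable_actgraph : definable M actgraph := dcmap_graph (dGset_act hX).

Lemma actgraphP g x y :
  actgraph (row_mx (row_mx g x) y) <-> [/\ G g, X x & y = act g x].
Proof.
split=> [[z [Gz Xz] /eq_row_mx[zgx zy]]|[Gg Xx ->]].
  by move: Gz Xz zy; rewrite zgx row_mxKl row_mxKr => ? ? <-.
by exists (row_mx g x); rewrite /set_prod /= ?row_mxKl ?row_mxKr.
Qed.

Lemma act_closed g x : G g -> X x -> X (act g x).
Proof.
move=> Gg Xx; have := dcmap_sub (dGset_act hX) (x := row_mx g x).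
by rewrite /= row_mxKl row_mxKr; apply; rewrite /set_prod /= row_mxKl row_mxKr.
Qed.

Lemma actKV g x : G g -> X x -> act (inv g) (act g x) = x.
Proof.
move=> Gg Xx; have Gi : G (inv g) := dcmap_sub (dgroup_inv hG) Gg.
rewrite -(dGset_actM hX) // (dgroup_mulVl hG) //.
exact: (dGset_act1 hX).
Qed.

Definition orbit_rel x y := exists g, actgraph (row_mx (row_mx g x) y).

Lemma orbit_refl x : X x -> orbit_rel x x.
Proof.
move=> Xx; exists one; apply/actgraphP; split=> //; first exact: dgroup_one hG.
by rewrite (dGset_act1 hX).
Qed.

Lemma orbit_act g x y : G g -> X x -> orbit_rel (act g x) y <-> orbit_rel x y.
Proof.
move=> Gg Xx; have Gi : G (inv g) := dcmap_sub (dgroup_inv hG) Gg.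
have mulG h k : G h -> G k -> G (mul h k).
  move=> Gh Gk; have := dcmap_sub (dgroup_mul hG) (x := row_mx h k).
  rewrite /= row_mxKl row_mxKr; apply.
  by rewrite /set_prod /= row_mxKl row_mxKr.
(* Group elements leading to [y] from [act g x] and from [x] differ by right multiplication by [g]
   or its inverse. *)
split=> -[h /actgraphP[Gh Xgx ->]].
  exists (mul h g); apply/actgraphP; split=> //; first exact: mulG.
  by rewrite (dGset_actM hX).
exists (mul h (inv g)); apply/actgraphP; split=> //; first exact: mulG.
  exact: act_closed.
by rewrite (dGset_actM hX) ?actKV //; exact: act_closed.
Qed.

(** * The barrier and the heights *)

(** This is [A] together with the points of the closure of [X] outside [X]: keeping a distance from
    it prevents limits from falling into [A] or out of [X]. *)
Definition barrier : set 'rV[F]_m := closure X `\` (X `\` A).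

Lemma definable_barrier : definable M barrier.
Proof.
apply: Def_definable; apply: (@Def_ext _ _ _ _ (fun x : 'rV[F]_m =>
  (forall e, 0 < e -> exists y, X y /\ `|x - y| < e) /\ ~ (X x /\ ~ A x))).
  by move=> x; rewrite -closure_rowP.
by definability.
Qed.

(** Local closedness of [X] keeps the points of its closure outside [X] away from [x]; relative
    closedness of [A] keeps [A] away. *)
Lemma barrier_far x : X x -> ~ A x ->
  exists2 e, 0 < e & forall w, barrier w -> e <= `|x - w|.
Proof.
move=> Xx nAx; have [e e0 He] := locally_closed_locally hXlc Xx.
have [V cV VA] := proj1 (@closed_subspaceP _ X A) hAcl.
have /nbhs_rowP[d d0 Hd] : nbhs x (~` V).
  apply: (@open_nbhs_nbhs _ x); split; first exact: closed_openC.
  move=> Vx; have : (V `&` X) x by [].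
  by rewrite VA => -[].
exists (Num.min d e); first by rewrite lt_min d0.
move=> w [Xw nw]; rewrite leNgt lt_min; apply/negP => /andP[/Hd nVw /He Hw].
apply: nw; split; first exact: Hw.
move=> Aw; apply: nVw; have : (A `&` X) w by split=> //; exact: hAX.
by rewrite -VA => -[].
Qed.

(** A relation, true of all [r] from 0 up to the height of [y]. This avoids the infimum defining the
    distance, also when the barrier is empty, and a division by the norm at 0. *)
Definition height (y : 'rV[F]_m) (r : F) :=
  0 <= r /\ r <= 1 /\ r * `|y| <= 1 /\ forall w, barrier w -> r <= `|y - w|.

Lemma height_le y r s : height y r -> 0 <= s -> s <= r -> height y s.
Proof.
move=> [r0 [r1 [ry rw]]] s0 sr; split=> //; split; first exact: le_trans r1.
split=> [|w /rw]; last exact: le_trans.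
by apply: le_trans ry; exact: ler_wpM2r.
Qed.

Lemma height_gt0 y r : X y -> height y r -> 0 < r -> ~ A y.
Proof.
move=> Xy [_ [_ [_ rw]]] r0 Ay; have : barrier y.
  by split; [exact: subset_closure | case].
by move=> /rw; rewrite subrr normr0 leNgt r0.
Qed.

(** The clause [r <= 0] makes the set nonempty for every [x], even outside [X], and its supremum
    nonnegative. *)
Definition orbit_height x r := r <= 0 \/ exists y, orbit_rel x y /\ height y r.

Lemma orbit_height_sup x :
  exists s, (forall r, orbit_height x r -> r <= s) /\
            forall u, (forall r, orbit_height x r -> r <= u) -> s <= u.
Proof.
apply: (@Def_sup _ _ hdc _ 1).
- have hB := definable_barrier.
  by rewrite /orbit_height /orbit_rel /height; definability.
- by exists 0; left.
- by move=> r [/le_trans->//|[y [_ [_ []]]]].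
Qed.


Lemma orbit_rel_act g x : G g -> X x -> orbit_rel x (act g x).
Proof. by move=> Gg Xx; exists g; apply/actgraphP. Qed.

(** * Closed bounded superlevel sets of the height *)

Definition superlevel (s : F) : set 'rV[F]_m :=
  [set y | (X y /\ ~ A y) /\ height y s].

Lemma definable_superlevel s : definable M (superlevel s).
Proof.
have hB := definable_barrier.
by apply: Def_definable; rewrite /superlevel /height /mkset; definability.
Qed.

Lemma bounded_superlevel s : 0 < s -> bounded_set (superlevel s).
Proof.
move=> s0; apply/bounded_rowP; exists (s^-1) => y [_ [_ [_ [sy _]]]].
by rewrite -[leRHS]mul1r ler_pdivlMr // mulrC.
Qed.

Lemma closed_superlevel s : 0 < s -> closed (superlevel s).
Proof.
move=> s0; apply/closed_rowP => y ys.
have [_ _ [_ [_ [s1 _]]]] : exists2 z, True & superlevel s z.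
  by have [z] := ys 1 ltr01; exists z.
have hy : height y s.
  split; first exact: ltW.
  do 2 split=> //.
    (* A point [z] of the set within [e] of [y] gives an error [s * e], at most [e] because
       [s <= 1]. *)
    apply/ler_addgt0Pr => e e0; have [z [_ [_ [_ [sz _]]]] yz] := ys e e0.
    have : `|y| <= `|z| + e.
      by rewrite -[y](subrK z) addrC (le_trans (ler_normD _ _)) // lerD2l ltW.
    move=> /(ler_wpM2l (ltW s0)) /le_trans; apply; rewrite mulrDr lerD //.
    by rewrite -[leRHS]mul1r ler_wpM2r // ltW.
  move=> w Bw; apply/ler_addgt0Pr => e e0.
  have [z [_ [_ [_ [_ zw]]]] yz] := ys e e0.
  apply: le_trans (zw _ Bw) _; have -> : z - w = (y - w) - (y - z).
    by rewrite opprB [RHS]addrC addrA subrK.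
  by rewrite (le_trans (ler_normB _ _)) // lerD2l ltW.
split=> //; have clX : closure X y.
  apply/closure_rowP => e e0; have [z [[Xz _] _] yz] := ys e e0.
  by exists z.
(* A limit outside [X] or inside [A] would lie in the barrier, at distance 0 from itself, against
   [0 < s]. *)
apply: contrapT => nD; have By : barrier y by split.
case: hy => _ [_ [_ /(_ y By)]].
by rewrite subrr normr0 leNgt s0.
Qed.

(** * Invariance, zeros, continuity and definability of the supremum *)

Section OrbitSup.
Context (f : 'rV[F]_m -> F).
Context (fub : forall x r, orbit_height x r -> r <= f x).
Context (flub : forall x u, (forall r, orbit_height x r -> r <= u) -> f x <= u).

Lemma orbit_sup_ge0 x : 0 <= f x.
Proof. by apply: fub; left. Qed.

(** As [s] is nonnegative, the clause [r <= 0] cannot account for a value above it, so a point of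
    the orbit does. *)
Lemma orbit_sup_approx x s : 0 <= s -> s < f x ->
  exists y r, [/\ orbit_rel x y, height y r & s < r].
Proof.
move=> s0 sf; apply: contrapT => H; move: sf; rewrite ltNge => /negP; apply.
apply: flub => r [/le_trans-> //|[y [xy yr]]]; rewrite leNgt; apply/negP => sr.
by apply: H; exists y, r.
Qed.

Lemma orbit_sup_invariant : invariant_function G X act f.
Proof.
(* One inequality suffices: the reverse one is the same applied to the inverse of [g] at
   [act g x]. *)
have H g x : G g -> X x -> f (act g x) <= f x.
  move=> Gg Xx; apply: flub => r [r0|[y [/orbit_act-/(_ Gg Xx) xy yr]]].
    exact: le_trans (orbit_sup_ge0 x).
  by apply: fub; right; exists y.
move=> g x Gg Xx; apply/eqP; rewrite eq_le H //=.
rewrite -{1}(actKV Gg Xx) H //; last exact: act_closed.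
exact: (dcmap_sub (dgroup_inv hG)).
Qed.

Lemma orbit_sup_zeros : X `&` f @^-1` [set 0] = A.
Proof.
apply/seteqP; split=> [x [Xx /= fx]|x Ax].
  apply: contrapT => nAx; have [e e0 He] := barrier_far Xx nAx.
  (* A positive height of [x] itself: [e] handles the barrier, and the inverse handles both the norm
     and the cap 1. *)
  pose r := Num.min e (1 + `|x|)^-1.
  have x1 : 0 < 1 + `|x| by rewrite ltr_wpDr.
  have r0 : 0 < r by rewrite lt_min e0 invr_gt0.
  have : r <= f x.
    apply: fub; right; exists x; split; first exact: orbit_refl.
    have rx : r <= (1 + `|x|)^-1 by rewrite ge_min lexx orbT.
    split; first exact: ltW.
    split; first by rewrite (le_trans rx) // invf_le1 // lerDl.
    split; last by move=> w /He; apply: le_trans; rewrite ge_min lexx.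
    have := ler_wpM2r (normr_ge0 x) rx; move/le_trans; apply.
    by rewrite mulrC ler_pdivrMr // mul1r lerDr.
  by rewrite fx leNgt r0.
split; first exact: hAX.
apply/eqP; rewrite /= eq_le orbit_sup_ge0 andbT; apply: flub => r [//|[y []]].
move=> [g /actgraphP[Gg Xx ->]] yr; rewrite leNgt; apply/negP => r0.
by apply: (height_gt0 _ yr r0); [exact: act_closed | exact: hAinv].
Qed.

Lemma orbit_sup_lower x s : X x -> 0 <= s -> s < f x ->
  exists2 d, 0 < d & forall y, X y -> `|x - y| < d -> s <= f y.
Proof.
move=> Xx s0 /orbit_sup_approx-/(_ s0)[z [r [[g /actgraphP[Gg _ ->]] gr sr]]].
have [r0 [r1 [rg rw]]] := gr.
have sg : s * `|act g x| < 1.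
  have [->|gx0] := eqVneq `|act g x| 0; first by rewrite mulr0.
  by apply: lt_le_trans rg; rewrite ltr_pM2r // lt_def gx0 normr_ge0.
(* The slack that height [s] leaves at [act g x] in the barrier and norm conditions. By continuity
   of the action, [act g y] then still has height [s]. *)
pose e := Num.min (r - s) (1 - s * `|act g x|).
have e0 : 0 < e by rewrite lt_min !subr_gt0 sr.
have /within_continuousP/(_ (row_mx g x)) := dcmap_cont (dGset_act hX).
case/(_ _ e e0) => [|d d0 Hd]; first by rewrite /set_prod /= row_mxKl row_mxKr.
exists d => // y Xy xy; apply: fub; right; exists (act g y).
split; first exact: orbit_rel_act.
have := Hd (row_mx g y); rewrite /set_prod /= !row_mxKl !row_mxKr.
have gxy : `|row_mx g x - row_mx g y| < d.
  rewrite opp_row_mx add_row_mx subrr; apply: row_norm_lt => // i.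
  case: (split_ordP i) => j ->; first by rewrite row_mxEl mxE normr0.
  by rewrite row_mxEr (le_lt_trans (le_coord_norm _ j)).
move=> /(_ (conj Gg Xy) gxy); rewrite lt_min => /andP[yr ys].
split=> //; split; first exact: le_trans (ltW sr) r1.
split=> [|w /rw gw].
  have : `|act g y| <= `|act g x| + (1 - s * `|act g x|).
    rewrite -[act g y](subKr (act g x)) (le_trans (ler_normB _ _)) //.
    by rewrite lerD2l ltW.
  move=> /(ler_wpM2l s0)/le_trans; apply; rewrite mulrDr -lerBrDl.
  rewrite -[leRHS]mul1r ler_wpM2r ?subr_ge0 ?(ltW sg) //.
  exact: le_trans (ltW sr) r1.
rewrite -(lerD2r (r - s)) addrC subrK; apply: le_trans gw _.
have -> : act g x - w = (act g y - w) + (act g x - act g y).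
  by rewrite [RHS]addrC addrA subrK.
by rewrite (le_trans (ler_normD _ _)) // lerD2l ltW.
Qed.

Lemma orbit_sup_upper x s : X x -> f x < s ->
  exists2 d, 0 < d & forall y, X y -> `|x - y| < d -> f y <= s.
Proof.
move=> Xx fs; have s0 : 0 < s := le_lt_trans (orbit_sup_ge0 x) fs.
apply: contrapT => /forall2NP Hd.
have [d d0 Bx] := locally_closed_locally hXlc Xx.
(* Radius [d / 2] keeps the closed ball inside the open ball of radius [d], where [X] contains its
   limits; hence [B] is closed in the whole space. *)
pose B : set 'rV[F]_m := [set y | X y /\ `|x - y| <= d / 2].
have hB : definable M B.
  by apply: Def_definable; rewrite /B /mkset; definability.
have hK := definable_superlevel s.
have cK := closed_superlevel s0.
have cB : closed B.
  apply/closed_rowP => y yB; have yd : `|x - y| <= d / 2.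
    apply/ler_addgt0Pr => e e0; have [z [_ xz] yz] := yB e e0.
    have -> : x - y = (x - z) - (y - z) by rewrite opprB addrA subrK.
    by rewrite (le_trans (ler_normB _ _)) // lerD // ltW.
  split=> //; apply: Bx.
    by rewrite (le_lt_trans yd) // ltr_pdivrMr // ltr_pMr // ltr1n.
  by apply/closure_rowP => e /yB[z [Xz _] yz]; exists z.
have [b bK] := proj1 (bounded_rowP _) (bounded_superlevel s0).
pose C := set_prod B (superlevel s).
have hC : definable M C.
  by apply: Def_definable; rewrite /C /set_prod /mkset; definability.
have leC (z : 'rV[F]_(m + m)) : `|lsubmx z| <= `|z| /\ `|rsubmx z| <= `|z|.
  by split; apply: row_norm_le => // i; rewrite mxE le_coord_norm.
have cC : closed C.
  apply/closed_rowP => z zC; split.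
    apply: (proj1 (closed_rowP _) cB) => e /zC[y [By _] zy].
    exists (lsubmx y) => //; apply: le_lt_trans zy.
    by rewrite -raddfB; have [] := leC (z - y).
  apply: (proj1 (closed_rowP _) cK) => e /zC[y [_ Ky] zy].
  exists (rsubmx y) => //; apply: le_lt_trans zy.
  by rewrite -raddfB; have [] := leC (z - y).
have bC : bounded_set C.
  apply/bounded_rowP; exists (Num.max (`|x| + d / 2) b) => z [[_ xz] /bK zb].
  apply: row_norm_le => [|i].
    by rewrite le_max addr_ge0 // divr_ge0 // ltW.
  rewrite -[z]hsubmxK le_max; case: (split_ordP i) => j ->.
    rewrite row_mxEl (le_trans (le_coord_norm _ j)) //.
    rewrite -[lsubmx z](subKr x) (le_trans (ler_normB _ _)) //.
    by rewrite lerD2l.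
  by rewrite row_mxEr (le_trans (le_coord_norm _ j) zb) orbT.
have CX : C `<=` set_prod X X by move=> z [[Xz _] [[Xz' _] _]]; split.
have [_ /(_ C hC cC bC CX)[cP bP]] := hproper.
(* The pairs of [g] and [y] in [B] with [act g y] in the superlevel set. *)
set P := _ `&` _ in cP bP.
have PE z : P z <-> [/\ G (lsubmx z), B (rsubmx z) &
    superlevel s (act (lsubmx z) (rsubmx z))].
  rewrite /P /C /set_prod /= /preimage /= row_mxKl row_mxKr.
  split=> [[[Gz Xz] [Bz Kz]]|[Gz Bz Kz]] //; split=> //; split=> //.
  by case: Bz.
have hP : definable M P.
  apply: Def_definable; apply: (@Def_ext _ _ _ _ (fun z : 'rV[F]_(n + m) =>
    B (rsubmx z) /\ exists y, actgraph (row_mx z y) /\ superlevel s y)).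
    move=> z; rewrite PE -{2}[z]hsubmxK; split=> [[Bz [y []]]|[Gz Bz Kz]].
      by move=> /actgraphP[Gz _ ->].
    split=> //; exists (act (lsubmx z) (rsubmx z)); split=> //.
    by apply/actgraphP; split=> //; case: Bz.
  by definability.
(* The assumed points [y] near [x] with [f y > s] lie in the projection of [P], so [x] does too,
   which forces [s <= f x]. *)
have [|g /PE[]] := closed_bounded_projection hdc (x := x) hP cP bP.
  move=> e e0; have ed0 : 0 < Num.min e (d / 2) by rewrite lt_min e0 divr_gt0.
  have [/(_ ed0)//|] := Hd (Num.min e (d / 2)).
  move=> /existsNP[y /not_implyP[Xy /not_implyP[]]].
  rewrite lt_min => /andP[xye xyd] /negP; rewrite -ltNge => sy.
  have [_ [r [[g /actgraphP[Gg _ ->]] hr sr]]] := orbit_sup_approx (ltW s0) sy.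
  exists (row_mx g y); last by rewrite row_mxKr.
  apply/PE; rewrite row_mxKl row_mxKr; split=> //.
    by split=> //; exact: ltW.
  have Xgy := act_closed Gg Xy.
  split; last exact: height_le hr (ltW s0) (ltW sr).
  by split=> //; apply: (height_gt0 Xgy hr); exact: lt_trans sr.
rewrite row_mxKl row_mxKr => Gg _ [_ hs].
have : s <= f x.
  by apply: fub; right; exists (act g x); split=> //; exact: orbit_rel_act.
by rewrite leNgt fs.
Qed.

Lemma orbit_sup_continuous : {within X, continuous f}.
Proof.
apply/within_continuousP => x Xx e e0.
have e2 : 0 < e / 2 by rewrite divr_gt0.
have ee : e / 2 < e by rewrite ltr_pdivrMr // ltr_pMr // ltr1n.
have [|d d0 Hd] := @orbit_sup_upper x (f x + e / 2) Xx; first by rewrite ltrDl.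
have [d' d'0 Hd'] : exists2 d', 0 < d' &
    forall y, X y -> `|x - y| < d' -> f x - e / 2 <= f y.
  (* [orbit_sup_lower] requires a nonnegative level; below 0 the bound holds because [f] is
     nonnegative. *)
  have [s0|s0] := leP 0 (f x - e / 2).
    by apply: orbit_sup_lower => //; rewrite gtrDl oppr_lt0.
  by exists 1 => // y _ _; apply: le_trans (ltW s0) (orbit_sup_ge0 y).
exists (Num.min d d'); first by rewrite lt_min d0.
move=> y Xy; rewrite lt_min => /andP[xd xd'].
rewrite distrC; apply: le_lt_trans ee; rewrite ler_distl.
by rewrite Hd' // Hd.
Qed.

(** Being the least upper bound of [orbit_height] is a first-order condition on the value and
    determines it. *)
Lemma orbit_sup_definable :
  definable M (graph X (fun x => const_mx (f x) : 'rV[F]_1)).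
Proof.
have hB := definable_barrier.
apply: Def_definable; apply: (@Def_ext _ _ _ _ (fun z : 'rV[F]_(m + 1) =>
  X (lsubmx z) /\
  ((forall r, orbit_height (lsubmx z) r -> r <= z 0 (rshift m 0)) /\
   (forall u, (forall r, orbit_height (lsubmx z) r -> r <= u) ->
     z 0 (rshift m 0) <= u)))); last first.
  by rewrite /orbit_height /orbit_rel /height; definability.
move=> z; split=> [[Xz [zub zlub]]|[x Xx <-]].
  exists (lsubmx z) => //; rewrite -[RHS]hsubmxK; congr row_mx.
  apply/rowP => i; rewrite ord1 !mxE; apply/eqP; rewrite eq_le.
  by apply/andP; split; [apply: flub | apply: zlub => r; exact: fub].
rewrite row_mxKl row_mxEr mxE; split=> //; split=> [r /fub|u] //.
exact: flub.
Qed.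

End OrbitSup.

End InvariantFunction.

Unset Implicit Arguments.
Set Strict Implicit.

Theorem theorem5p5 (F : realFieldType) (M : expansion F)
    (hdc : definably_complete M) (hlo : locally_o_minimal M)
    (n m : nat)
    (G : set 'rV[F]_n) (mul : 'rV[F]_n -> 'rV[F]_n -> 'rV[F]_n)
    (inv : 'rV[F]_n -> 'rV[F]_n) (one : 'rV[F]_n)
    (hG : definable_group M G mul inv one)
    (X : set 'rV[F]_m) (act : 'rV[F]_n -> 'rV[F]_m -> 'rV[F]_m)
    (hX : definable_Gset M G mul one X act)
    (hXlc : locally_closed X)
    (A : set 'rV[F]_m) (hA : definable M A) (hAX : A `<=` X)
    (hAinv : invariant_set G act A)
    (hAcl : closed (A : set (subspace X)))
    (hproper : definably_proper_action M G X act) :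
  exists f : 'rV[F]_m -> F,
    [/\ definable_continuous_function M X f,
        invariant_function G X act f &
        X `&` f @^-1` [set 0] = A].
Proof.
(* Least upper bounds are unique, so the chosen function is determined, and can be definable. *)
have [f fsup] := choice (@orbit_height_sup F M hdc n m G mul one X act hX A hA).
have fub x := (fsup x).1; have flub x := (fsup x).2.
exists f; split.
- split; [exact: dGset_set hX | exact: (orbit_sup_definable hX hA fub flub) |].
  exact: (orbit_sup_continuous hdc hX hXlc hA hproper fub flub).
- exact: (orbit_sup_invariant hG hX fub flub).
- exact: (orbit_sup_zeros hG hX hXlc hAX hAinv hAcl fub flub).
Qed.
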